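(* Let $\mathbb{K}$ be an algebraically closed field of characteristic zero and let $B$ be an affine $\mathbb{K}$-algebra. If $D\colon B\to B$ is a locally finite derivation with $D\neq 0$, then the isotropy group $\operatorname{Aut}(B)_D=\{\varphi\in\operatorname{Aut}(B)\mid \varphi D=D\varphi\}$ is nontrivial, i.e. it contains an automorphism different from $\mathrm{id}_B$.
   Context: An affine $\mathbb{K}$-algebra is a finitely generated commutative $\mathbb{K}$-algebra. $\operatorname{Aut}(B)$ is the group of $\mathbb{K}$-algebra automorphisms of $B$. A derivation of $B$ is a $\mathbb{K}$-linear map $D\colon B\to B$ with $D(ab)=aD(b)+bD(a)$ for all $a,b\in B$. It is locally finite if for every $b\in B$ the $\mathbb{K}$-vector space spanned by $\{D^n(b)\mid n\ge 0\}$ is finite-dimensional. *)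

(* Defs.v *)
From mathcomp Require Import all_boot all_algebra.
From mathcomp Require Import mpoly.

Set Implicit Arguments.
Unset Strict Implicit.
Unset Printing Implicit Defensive.

Import GRing.Theory.
Local Open Scope ring_scope.

Definition affine (K : fieldType) (B : comAlgType K) : Prop :=
  exists (n : nat) (x : 'I_n -> B),
    forall b : B, exists p : {mpoly K[n]}, b = mmap (in_alg B) x p.

Definition derivation (K : fieldType) (B : comAlgType K)
    (D : {linear B -> B}) : Prop :=
  forall a b : B, D (a * b) = a * D b + b * D a.

Definition lin_span (K : fieldType) (V : lmodType K) (S : V -> Prop)
    (v : V) : Prop :=
  exists (s : seq V) (c : 'I_(size s) -> K),
    (forall x : V, x \in s -> S x) /\ v = \sum_(i < size s) c i *: s`_i.

Definition finite_dim (K : fieldType) (V : lmodType K) (W : V -> Prop) : Prop :=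
  exists s : seq V, forall v : V, W v <-> lin_span (fun x => x \in s) v.

Definition locally_finite (K : fieldType) (V : lmodType K)
    (D : {linear V -> V}) : Prop :=
  forall b : V, finite_dim (lin_span (fun v => exists n : nat, v = iter n D b)).

(* Elements of Aut(B) are the bijective K-algebra endomorphisms of B. *)
Definition automorphism (K : fieldType) (B : comAlgType K)
    (phi : {lrmorphism B -> B}) : Prop := bijective phi.

Definition isotropy (K : fieldType) (B : comAlgType K) (D : {linear B -> B})
    (phi : {lrmorphism B -> B}) : Prop :=
  automorphism phi /\ forall b : B, phi (D b) = D (phi b).

(* Main.v *)
(* If D has a generalized eigenvector b for an eigenvalue a <> 0, decompose a
   finite set of generators of B into generalized eigenvectors. Their eigenvalues
   lie in a finitely generated subgroup of K, on which there is a character chi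
   to K^* with chi(a) <> 1. Since products of generalized eigenvectors for mu and
   nu are generalized eigenvectors for mu + nu, multiplication by chi(mu) on each
   generalized eigenspace is an automorphism; it commutes with D and moves b.
   Otherwise D is locally nilpotent and exp(D) commutes with D; if D^m b = 0 with
   m >= 2 minimal, then exp(D) moves D^(m-2) b to D^(m-2) b + D^(m-1) b. *)
Require Import Defs.
From HB Require Import structures.
From mathcomp Require Import all_boot all_algebra.
From mathcomp Require Import ring.
From mathcomp Require mpoly.
From Stdlib Require Import Classical IndefiniteDescription.

Set Implicit Arguments.
Unset Strict Implicit.
Unset Printing Implicit Defensive.

Import GRing.Theory.
Local Open Scope ring_scope.

(** * Automorphisms given by their graphs *)

(** Both automorphisms are known only through local data (a decomposition, a nilpotency exponent),
    so they are built as graphs; uniqueness of values carries the closure properties of the graph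
    over to the function chosen from it. *)
Lemma isotropy_of_relation (K : fieldType) (B : comAlgType K)
    (D : {linear B -> B}) (G : B -> B -> Prop) :
  (forall b, exists c, G b c) -> (forall c, exists b, G b c) ->
  (forall b c c', G b c -> G b c' -> c = c') ->
  (forall b b' c, G b c -> G b' c -> b = b') ->
  G 1 1 ->
  (forall b c b' c', G b c -> G b' c' -> G (b + b') (c + c')) ->
  (forall b c b' c', G b c -> G b' c' -> G (b * b') (c * c')) ->
  (forall k b c, G b c -> G (k *: b) (k *: c)) ->
  (forall b c, G b c -> G (D b) (D c)) ->
  exists phi : {lrmorphism B -> B}, isotropy D phi /\ forall b, G b (phi b).
Proof.
move=> totG surG funG injG G1 GD GM GZ GDer.
have [f fP] := functional_choice _ totG.
have [g gP] := functional_choice _ surG.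
have flin : linear f.
  by move=> k a b; apply: funG (fP _) _; apply: GD (fP b); apply: GZ (fP a).
have fmul : monoid_morphism f.
  split; first exact: funG (fP _) G1.
  by move=> a b; apply: funG (fP _) _; apply: GM.
pose lin := GRing.isLinear.Build K B B *:%R f flin.
pose mul := GRing.isMonoidMorphism.Build B B f fmul.
pose phi : {lrmorphism B -> B} := HB.pack f lin mul.
exists phi; split; last exact: fP.
split.
  exists g => b; first exact: injG (gP _) (fP _).
  exact: funG (fP _) (gP _).
by move=> b; apply/esym; apply: funG (fP _); apply: GDer.
Qed.

(** * The action of K[X] on V through D *)

Section PolyAction.

Variables (K : fieldType) (V : lmodType K) (D : {linear V -> V}).

(** The K[X]-module structure in which X acts as D, that is, p(D) v. *)
Definition pact (p : {poly K}) (v : V) : V :=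
  \sum_(i < size p) p`_i *: iter i D v.

Lemma pact_wide n (p : {poly K}) v :
  (size p <= n)%N -> pact p v = \sum_(i < n) p`_i *: iter i D v.
Proof.
move=> le_pn; rewrite /pact (big_ord_widen n (fun i => p`_i *: iter i D v)) //.
rewrite big_mkcond; apply: eq_bigr => i _; case: ltnP => // le_pi.
by rewrite nth_default ?scale0r.
Qed.

Lemma pact_linearl v : linear (pact^~ v).
Proof.
move=> k p q; pose n := maxn (size p) (size q).
have ltn : (size (k *: p + q)%R <= n)%N.
  rewrite (leq_trans (size_polyD _ _)) // geq_max leq_maxr andbT.
  by rewrite (leq_trans (size_scale_leq _ _)) ?leq_maxl.
rewrite (pact_wide _ ltn) (@pact_wide n p) ?leq_maxl //.
rewrite (@pact_wide n q) ?leq_maxr // scaler_sumr -big_split /=.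
by apply: eq_bigr => i _; rewrite coefD coefZ scalerDl scalerA.
Qed.

Lemma iter_linear n : linear (iter n D).
Proof.
move=> k u v; elim: n => // n IHn /=.
by rewrite IHn linearP.
Qed.

Lemma pact_linearr p : linear (pact p).
Proof.
move=> k u v; rewrite /pact scaler_sumr -big_split /=; apply: eq_bigr => i _.
by rewrite iter_linear scalerDr !scalerA mulrC.
Qed.

HB.instance Definition _ p :=
  GRing.isLinear.Build K V V *:%R (pact p) (pact_linearr p).

Lemma pactD p q v : pact (p + q) v = pact p v + pact q v.
Proof. by have := pact_linearl v 1 p q; rewrite !scale1r. Qed.

Lemma pact0 v : pact 0 v = 0.
Proof. by rewrite /pact size_poly0 big_ord0. Qed.

Lemma pactZ k p v : pact (k *: p) v = k *: pact p v.
Proof. by have := pact_linearl v k p 0; rewrite !addr0 pact0 addr0. Qed.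

Lemma pactN p v : pact (- p) v = - pact p v.
Proof. by rewrite -(scaleN1r p) pactZ scaleN1r. Qed.

Lemma pactC k v : pact k%:P v = k *: v.
Proof.
by rewrite (@pact_wide 1) ?size_polyC_leq1 // big_ord1 coefC eqxx.
Qed.

Lemma pactMX p v : pact (p * 'X) v = pact p (D v).
Proof.
rewrite (@pact_wide (size p).+1) ?(leq_trans (size_polyMleq _ _)) //; last first.
  by rewrite size_polyX addn2.
rewrite big_ord_recl coefMX eqxx scale0r add0r; apply: eq_bigr => i _.
by rewrite coefMX /= -iterSr.
Qed.

Lemma pact_comm p v : pact p (D v) = D (pact p v).
Proof.
rewrite /pact linear_sum; apply: eq_bigr => i _.
by rewrite linearZ -iterSr.
Qed.

Lemma pactM p q v : pact (p * q) v = pact p (pact q v).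
Proof.
elim/poly_ind: q v => [|q c IHq] v; first by rewrite mulr0 !pact0 linear0.
rewrite mulrDr mulrA pactD pactMX IHq pactD pactMX linearD /=; congr (_ + _).
by rewrite mulrC mul_polyC pactZ pactC linearZ.
Qed.

Lemma pactX v : pact 'X v = D v.
Proof. by rewrite -['X]mul1r pactMX pactC scale1r. Qed.

Lemma pact_dvd0 (p q : {poly K}) v : p %| q -> pact p v = 0 -> pact q v = 0.
Proof. by case/dvdpP=> r -> pv0; rewrite pactM pv0 linear0. Qed.

(** The zero vector belongs to every [mu], so a claim that [mu] is an eigenvalue has to add that [v]
    is nonzero. *)
Definition gen_eigen (mu : K) (v : V) : Prop :=
  exists m, pact (('X - mu%:P) ^+ m) v = 0.

Lemma gen_eigen_stable mu v : gen_eigen mu v -> gen_eigen mu (D v).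
Proof. by case=> m mv0; exists m; rewrite pact_comm mv0 linear0. Qed.

Lemma locally_finite_annihilator v :
  locally_finite D -> exists2 p, p != 0 & pact p v = 0.
Proof.
move/(_ v) => [s sP]; pose n := size s.
have spanned i : exists c : {ffun 'I_n -> K}, iter i D v = \sum_j c j *: s`_j.
  have: lin_span (fun u => exists j, u = iter j D v) (iter i D v).
    exists [:: iter i D v], (fun=> 1); split.
      by move=> x; rewrite inE => /eqP ->; exists i.
    by rewrite big_ord1 scale1r.
  case/sP=> s' [c [s's ->]].
  apply: (big_ind (fun u => exists c : {ffun 'I_n -> K}, u = \sum_j c j *: s`_j)).
  - by exists [ffun=> 0]; rewrite big1 // => j _; rewrite ffunE scale0r.
  - move=> _ _ [c1 ->] [c2 ->]; exists [ffun j => c1 j + c2 j].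
    by rewrite -big_split; apply: eq_bigr => j _; rewrite ffunE scalerDl.
  move=> j _; have /(nthP 0) [k ltkn <-] : s'`_j \in s by apply/s's/mem_nth.
  exists [ffun l => if l == Ordinal ltkn then c j else 0].
  rewrite (bigD1 (Ordinal ltkn)) //= ffunE eqxx big1 ?addr0 // => l /negPf nl.
  by rewrite ffunE nl scale0r.
have [c cP] := functional_choice _ spanned.
(* The n + 1 first iterates have coordinates in n spanning vectors; a nonzero row vector in the left
   kernel of [A] lists the coefficients of the annihilator. *)
pose A := \matrix_(i < n.+1, j < n) c i j.
have: kermx A != 0.
  rewrite -mxrank_eq0 mxrank_ker subn_eq0 -ltnNge ltnS; exact: rank_leq_col.
case/rowV0Pn=> w /sub_kermxP wA0 w_neq0; exists (rVpoly w).
  by apply: contraNneq w_neq0 => w0; rewrite -(rVpolyK w) w0 linear0.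
rewrite (@pact_wide n.+1) ?size_poly //.
transitivity (\sum_(j < n) (w *m A) 0 j *: s`_j); last first.
  by rewrite wA0 big1 // => j _; rewrite mxE scale0r.
under eq_bigr => i _ do rewrite coef_rVpoly_ord cP scaler_sumr.
rewrite exchange_big; apply: eq_bigr => j _ /=.
rewrite mxE scaler_suml; apply: eq_bigr => i _.
by rewrite mxE scalerA.
Qed.

End PolyAction.

(** * Coprime annihilators and polynomial interpolation *)

(** With a p + b q = 1, the two parts are (b q)(D) v and (a p)(D) v, each killed because (p q)(D) v
    = 0. *)
Lemma bezout_pact (K : fieldType) (V : lmodType K) (D : {linear V -> V})
    (p q : {poly K}) v :
  coprimep p q -> pact D (p * q) v = 0 ->
  exists x y, [/\ v = x + y, pact D p x = 0 & pact D q y = 0].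
Proof.
case/Bezout_eq1_coprimepP=> -[a b] /= ab1 pqv0.
exists (pact D (b * q) v), (pact D (a * p) v); split.
- by rewrite -pactD addrC ab1 pactC scale1r.
- by rewrite -pactM mulrCA pactM pqv0 linear0.
by rewrite -pactM mulrCA (mulrC q) pactM pqv0 linear0.
Qed.

Lemma coprimep_XsubC_exp (K : fieldType) m (p : {poly K}) x :
  ~~ root p x -> coprimep (('X - x%:P) ^+ m) p.
Proof. by move=> px; rewrite coprimep_expl // coprimep_sym coprimep_XsubC. Qed.

Lemma chinese_interpolation (K : fieldType) (f : K -> K) m (s : seq K) :
  exists p, forall x, x \in s -> ('X - x%:P) ^+ m %| p - (f x)%:P.
Proof.
elim: s => [|x s [p pP]]; first by exists 0.
have [xs|xNs] := boolP (x \in s).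
  by exists p => y; rewrite inE => /predU1P[->|]; apply: pP.
pose q := \prod_(y <- s) ('X - y%:P) ^+ m.
have qx : ~~ root q x.
  rewrite rootE horner_prod prodf_seq_neq0; apply/allP => y ys /=.
  rewrite !hornerE expf_neq0 // subr_eq0.
  by apply: contraNneq xNs => ->.
have /Bezout_eq1_coprimepP[[a b] /= ab1] := coprimep_XsubC_exp m qx.
(* Modulo the m-th powers, [b * q] is 1 at [x] and 0 at the points of [s], so the correction sets
   the value at [x] and leaves the others. *)
exists (p + b * q * ((f x)%:P - p)) => y; rewrite inE => /predU1P[->|ys].
  have -> : p + b * q * ((f x)%:P - p) - (f x)%:P =
     (p - (f x)%:P) * (1 - b * q).
    by ring.
  by rewrite -ab1 addrK mulrA dvdp_mull.
rewrite addrAC dvdp_add ?pP //.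
by rewrite dvdp_mulr // dvdp_mull // /q (big_rem y) //= dvdp_mulr.
Qed.

(** * Characters on subgroups of K in characteristic zero *)

Lemma natr_eq0_char0 (K : fieldType) (charK0 : [pchar K] =i pred0) n :
  (n%:R == 0 :> K) = (n == 0)%N.
Proof. by move/pcharf0P: charK0. Qed.

Lemma intr_eq0_char0 (K : fieldType) (charK0 : [pchar K] =i pred0) (k : int) :
  (k%:~R == 0 :> K) = (k == 0).
Proof.
case: k => n; first by rewrite -pmulrn natr_eq0_char0.
by rewrite NegzE mulrNz oppr_eq0 -pmulrn natr_eq0_char0 // oppr_eq0.
Qed.

Lemma expfz2_eq1 (K : fieldType) (charK0 : [pchar K] =i pred0) (k : int) :
  ((2%:R : K) ^ k == 1) = (k == 0).
Proof.
have nat2 n : ((2%:R : K) ^+ n.+1 == 1) = false.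
  have := natr_eq0_char0 charK0 (2 ^ n.+1 - 1).
  rewrite natrB ?expn_gt0 // natrX subr_eq0 => ->.
  by apply/negbTE; rewrite subn_eq0 -ltnNge (ltn_exp2l 0).
case: k => [[|n]|n] //; first by rewrite expr0z eqxx.
  exact: nat2.
by rewrite /exprz invr_eq1 nat2.
Qed.

Definition zsubmodule (V : zmodType) (H : V -> Prop) : Prop :=
  H 0 /\ forall x y, H x -> H y -> H (x - y).

Lemma zsubmoduleD (V : zmodType) (H : V -> Prop) x y :
  zsubmodule H -> H x -> H y -> H (x + y).
Proof.
move=> [H0 Hsub] Hx Hy; rewrite -(opprK y) -[- y]add0r.
by apply: (Hsub) => //; apply: Hsub.
Qed.

Lemma zsubmoduleMz (V : zmodType) (H : V -> Prop) x (k : int) :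
  zsubmodule H -> H x -> H (x *~ k).
Proof.
move=> subH Hx; have [H0 Hsub] := subH.
have HMn n : H (x *+ n) by elim: n => // n; rewrite mulrS; apply: zsubmoduleD.
case: k => n; first exact: HMn.
by rewrite NegzE mulrNz -sub0r; apply: Hsub => //; apply: HMn.
Qed.

(* Adding x to s, keep H if the conclusion holds for x already, and replace H by
   H + Z x otherwise. *)
Lemma exists_hyperplane (K : fieldType) (charK0 : [pchar K] =i pred0) (a : K)
    (s : seq K) : a != 0 ->
  exists H : K -> Prop,
    [/\ zsubmodule H, forall k : int, H (a *~ k) -> k = 0
      & forall x, x \in s ->
          exists n k : int, n <> 0 /\ H (x *~ n - a *~ k)].
Proof.
move=> a_neq0; elim: s => [|x s [H [subH aH sH]]].
  exists (fun x => x = 0); split=> //.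
    by split=> // x y -> ->; rewrite subr0.
  move=> k /eqP; rewrite -mulrzr mulf_eq0 (negPf a_neq0) intr_eq0_char0 //.
  by move/eqP.
have [Hx|Hx] := classic (exists n k : int, n <> 0 /\ H (x *~ n - a *~ k)).
  by exists H; split=> // y; rewrite inE => /predU1P[-> //|/sH].
have [H0 Hsub] := subH.
exists (fun y => exists m : int, H (y - x *~ m)); split.
- split; first by exists 0; rewrite mulr0z subr0.
  move=> y z [m Hm] [n Hn]; exists (m - n).
  rewrite (_ : _ - _ = (y - x *~ m) - (z - x *~ n)); first exact: Hsub.
  by rewrite mulrzBr; ring.
(* A nonzero [m] would put a nonzero multiple of [x] in H + Z a, which this case excludes. *)
- move=> k [m Hm]; have [m0|/eqP m_neq0] := eqVneq m 0.
    by apply: aH; rewrite m0 mulr0z subr0 in Hm.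
  case: Hx; exists m, k; split=> //.
  by rewrite -opprB -sub0r; apply: Hsub.
move=> y; rewrite inE => /predU1P[->|/sH [n [k [n0 Hy]]]].
  by exists 1, 0; split=> //; exists 1; rewrite mulr0z subr0 subrr.
by exists n, k; split=> //; exists 0; rewrite mulr0z subr0.
Qed.

(** The product of the individual multipliers works for all of [s]; having a single n is what makes
    x |-> k additive. *)
Lemma common_multiple (V : zmodType) (H : V -> Prop) (a : V) (s : seq V) :
  zsubmodule H ->
  (forall x, x \in s -> exists n k : int, n <> 0 /\ H (x *~ n - a *~ k)) ->
  exists2 n : int, n != 0 &
    forall x, x \in s -> exists k : int, H (x *~ n - a *~ k).
Proof.
move=> subH; elim: s => [|x s IHs] sH; first by exists 1.
have [|n n_neq0 nP] := IHs; first by move=> y ys; apply: sH; rewrite inE ys orbT.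
have [|m [k [/eqP m_neq0 Hx]]] := sH x; first exact: mem_head.
exists (m * n); first by rewrite mulf_neq0.
move=> y; rewrite inE => /predU1P[->|/nP [l Hy]].
  by exists (k * n); rewrite !mulrzA -mulrzBl; apply: zsubmoduleMz.
by exists (l * m); rewrite mulrC !mulrzA -mulrzBl; apply: zsubmoduleMz.
Qed.

(** [chi] is a total function constrained on [L] alone. Closure of [L] under sums is what products
    of generalized eigenvectors call for. *)
Definition partial_character (K : fieldType) (L : K -> Prop) (chi : K -> K) :=
  [/\ L 0 /\ chi 0 = 1,
      forall x y, L x -> L y -> L (x + y) /\ chi (x + y) = chi x * chi y
    & forall x, L x -> chi x != 0].

(* A nonzero multiple n x of each x in s is congruent to some k a modulo a
   subgroup H meeting Z a trivially, and the character is x |-> 2 ^ k; in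
   characteristic zero 2 has infinite order. *)
Lemma exists_partial_character (K : fieldType)
    (charK0 : [pchar K] =i pred0) (a : K) (s : seq K) : a != 0 ->
  exists L chi, [/\ partial_character L chi, L a, chi a != 1
                  & forall x, x \in s -> L x].
Proof.
move=> a_neq0; have [H [subH aH sH]] := exists_hyperplane charK0 s a_neq0.
have [H0 Hsub] := subH.
have [n n_neq0 nP] := common_multiple subH sH.
pose L x := exists k : int, H (x *~ n - a *~ k).
have [f fP] : exists f : K -> int, forall x, L x -> H (x *~ n - a *~ f x).
  apply: (functional_choice (fun x k => L x -> H (x *~ n - a *~ k))) => x.
  by have [[k Hk]|nL] := classic (L x); [exists k | exists 0].
(* Two exponents for the same x differ by some j with [a *~ j] in H, hence coincide. *)
have f_unique x k : H (x *~ n - a *~ k) -> f x = k.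
  move=> Hk; have Hf : H (x *~ n - a *~ f x) by apply: fP; exists k.
  apply/esym/eqP; rewrite -subr_eq0; apply/eqP/aH; rewrite mulrzBr.
  rewrite (_ : _ - _ = (x *~ n - a *~ f x) - (x *~ n - a *~ k)); last by ring.
  exact: Hsub.
have fD x y : L x -> L y -> H ((x + y) *~ n - a *~ (f x + f y)).
  move=> Lx Ly; rewrite mulrzDl mulrzDr opprD addrACA.
  by apply: zsubmoduleD => //; apply: fP.
have two_neq0 : 2%:R != 0 :> K by rewrite natr_eq0_char0.
exists L, (fun x => 2%:R ^ f x); split.
- split; last by move=> x _; apply: expfz_neq0.
    have H00 : H (0 *~ n - a *~ 0) by rewrite mul0rz mulr0z subr0.
    by split; [exists 0 | rewrite (f_unique 0 0)].
  move=> x y Lx Ly; split; first by exists (f x + f y); apply: fD.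
  by rewrite -expfzDr // (f_unique _ _ (fD _ _ Lx Ly)).
- by exists n; rewrite subrr.
- by rewrite (f_unique a n) ?subrr // expfz2_eq1.
by move=> x /nP.
Qed.

(** * Decomposition into generalized eigenvectors *)

(** Induction on the size of an annihilating polynomial: a root x is split off with its full
    multiplicity m, which makes the two factors coprime. *)
Lemma gen_eigen_decomposition (K : closedFieldType) (V : lmodType K)
    (D : {linear V -> V}) v : locally_finite D ->
  exists2 s : seq (K * V), (forall t, t \in s -> gen_eigen D t.1 t.2)
    & v = \sum_(t <- s) t.2.
Proof.
move=> /(locally_finite_annihilator v) [p].
have [n] := ubnP (size p); elim: n => // n IHn in p v * => le_pn p_neq0 pv0.
have [p1|/closed_rootP [x px]] := eqVneq (size p) 1%N.
  exists [::] => //; rewrite big_nil; apply/eqP.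
  move: p_neq0 pv0; rewrite (size1_polyC (eq_leq p1)) polyC_eq0 pactC => p_neq0 /eqP.
  by rewrite scaler_eq0 (negPf p_neq0).
have [m [q /implyP/(_ p_neq0) qx def_p]] := multiplicity_XsubC p x.
have m_gt0 : (0 < m)%N.
  by case: m def_p => // def_p; rewrite def_p expr0 mulr1 (negPf qx) in px.
have q_neq0 : q != 0 by apply: contraNneq p_neq0 => q0; rewrite def_p q0 mul0r.
rewrite def_p mulrC in pv0.
have [y [z [-> yP zP]]] := bezout_pact (coprimep_XsubC_exp m qx) pv0.
have [|s sP ->] := IHn q z _ q_neq0 zP.
  rewrite -ltnS (leq_trans _ le_pn) // ltnS def_p size_Mmonic ?monic_exp ?monicXsubC //.
  by rewrite size_exp_XsubC addnS /= -{1}[size q]addn0 ltn_add2l.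
exists ((x, y) :: s); last by rewrite big_cons.
by move=> t; rewrite inE => /predU1P[-> | /sP //]; exists m.
Qed.

(** * Automorphisms scaling the generalized eigenspaces of a derivation *)

Section DerivationAutomorphisms.

Variables (K : fieldType) (B : comAlgType K) (D : {linear B -> B}).
Hypothesis derD : derivation D.

Lemma derivation_one : D 1 = 0.
Proof.
have := derD 1 1; rewrite !mul1r => /eqP.
by rewrite -subr_eq subrr eq_sym => /eqP.
Qed.

Lemma derivation_scalar k : D k%:A = 0.
Proof. by rewrite linearZ /= derivation_one scaler0. Qed.

(* With T(l) = D - l, the Leibniz rule reads T(l + l') (a b) = T(l)a b + a T(l')b. *)
Lemma gen_eigenM mu nu a b :
  gen_eigen D mu a -> gen_eigen D nu b -> gen_eigen D (mu + nu) (a * b).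
Proof.
case=> m ma0 [n nb0]; exists (m + n)%N.
have pactS k x (v : B) : pact D (('X - x%:P) ^+ k.+1) v =
    pact D (('X - x%:P) ^+ k) (D v - x *: v).
  by rewrite exprSr pactM pactD pactX pactN pactC.
(* Induction on a bound for m + n: each Leibniz summand lowers one exponent by one, and a zero
   exponent means that its factor vanishes. *)
move: {2}(m + n)%N (leqnn (m + n)) => k.
elim: k m n a b ma0 nb0 => [|k IHk] [|m] [|n] a b ma0 nb0 le_k //.
all: try by move: ma0; rewrite expr0 (pactC D 1) scale1r => ->; rewrite mul0r linear0.
all: try by move: nb0; rewrite expr0 (pactC D 1) scale1r => ->; rewrite mulr0 linear0.
rewrite addSn pactS.
have -> : D (a * b) - (mu + nu) *: (a * b) =
  (D a - mu *: a) * b + a * (D b - nu *: b).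
  by rewrite derD mulrBl mulrBr scalerDl -scalerAl -scalerAr; ring.
rewrite linearD /= (IHk m n.+1) -?pactS // add0r.
by rewrite -addSnnS IHk -?pactS // addSnnS.
Qed.

Section Diagonal.

Variables (L : K -> Prop) (chi : K -> K).
Hypothesis charL : partial_character L chi.

(* The graph of the map acting as ch mu on the generalized eigenspace of mu, for
   mu in L; it is single-valued by diag_rel_functional. *)
Inductive diag_rel (ch : K -> K) : B -> B -> Prop :=
| Diag0 : diag_rel ch 0 0
| DiagS mu b x y : L mu -> gen_eigen D mu b -> diag_rel ch x y ->
    diag_rel ch (b + x) (ch mu *: b + y).

Lemma diag_relD ch x y x' y' :
  diag_rel ch x y -> diag_rel ch x' y' -> diag_rel ch (x + x') (y + y').
Proof.
move=> xy xy'; elim: xy => [|mu b u v Lmu mub _ IH]; first by rewrite !add0r.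
by rewrite -!addrA; apply: DiagS.
Qed.

Lemma diag_rel_eigen ch mu b :
  L mu -> gen_eigen D mu b -> diag_rel ch b (ch mu *: b).
Proof.
move=> Lmu mub; rewrite -[X in diag_rel _ X]addr0 -[X in diag_rel _ _ X]addr0.
exact: DiagS (Diag0 ch).
Qed.

(** Components for mu and nu multiply to one for mu + nu, where [chi] takes the value chi(mu)
    chi(nu). *)
Lemma diag_relM x y x' y' :
  diag_rel chi x y -> diag_rel chi x' y' -> diag_rel chi (x * x') (y * y').
Proof.
have [_ LD _] := charL.
move=> xy xy'; elim: xy => [|mu b u v Lmu mub _ IH].
  by rewrite !mul0r; apply: Diag0.
rewrite !mulrDl; apply: diag_relD => //.
elim: xy' => [|nu c w z Lnu nuc _ IHc]; first by rewrite !mulr0; apply: Diag0.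
rewrite !mulrDr; apply: diag_relD => //.
have [Lmunu chiD] := LD _ _ Lmu Lnu.
rewrite -scalerAl -scalerAr scalerA -chiD.
by apply: diag_rel_eigen => //; apply: gen_eigenM.
Qed.

Lemma diag_rel_scalar k : diag_rel chi k%:A k%:A.
Proof.
have [[L0 chi0] _ _] := charL.
rewrite -[X in diag_rel _ _ X]scale1r -chi0; apply: diag_rel_eigen => //.
by exists 1%N; rewrite expr1 subr0 pactX derivation_scalar.
Qed.

Lemma diag_rel_derivation ch x y :
  diag_rel ch x y -> diag_rel ch (D x) (D y).
Proof.
elim=> [|mu b u v Lmu mub _ IH]; first by rewrite linear0; apply: Diag0.
by rewrite !linearD linearZ; apply: DiagS => //; apply: gen_eigen_stable.
Qed.

(** The value is p(D) x for every p congruent to the right constants at finitely many mu;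
    quantifying over p lets two decompositions share one p. *)
Lemma diag_rel_pact ch x y : diag_rel ch x y ->
  exists (s : seq K) m, forall p : {poly K},
    (forall mu, mu \in s -> ('X - mu%:P) ^+ m %| p - (ch mu)%:P) ->
    pact D p x = y.
Proof.
elim=> [|mu b u v Lmu [n nb0] _ [s [m IH]]].
  by exists [::], 0%N => p _; rewrite linear0.
exists (mu :: s), (m + n)%N => p pP; rewrite linearD /=; congr (_ + _).
  apply/eqP; rewrite -subr_eq0 -[ch mu *: b](pactC D) -pactN -pactD; apply/eqP.
  apply: pact_dvd0 nb0; apply: dvdp_trans (pP mu (mem_head _ _)).
  by rewrite dvdp_exp2l ?leq_addl.
apply: IH => nu nus; apply: dvdp_trans (pP nu _); last by rewrite inE nus orbT.
by rewrite dvdp_exp2l ?leq_addr.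
Qed.

(* On finitely many generalized eigenspaces the map is a polynomial in D, so its
   value does not depend on the decomposition of the argument. *)
Lemma diag_rel_functional ch x y y' :
  diag_rel ch x y -> diag_rel ch x y' -> y = y'.
Proof.
move=> /diag_rel_pact [s [m sP]] /diag_rel_pact [s' [m' sP']].
have [p pP] := chinese_interpolation ch (m + m') (s ++ s').
rewrite -(sP p) => [|mu mus]; last first.
  apply: dvdp_trans (pP mu _); last by rewrite mem_cat mus.
  by rewrite dvdp_exp2l ?leq_addr.
apply: sP' => mu mus.
apply: dvdp_trans (pP mu _); last by rewrite mem_cat mus orbT.
by rewrite dvdp_exp2l ?leq_addl.
Qed.

Lemma diag_rel_inv ch ch' x y : (forall mu, L mu -> ch' mu * ch mu = 1) ->
  diag_rel ch x y -> diag_rel ch' y x.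
Proof.
move=> chV; elim=> [|mu b u v Lmu [m mub] _ IH]; first exact: Diag0.
rewrite -[X in diag_rel _ _ (X + _)]scale1r -(chV _ Lmu) -scalerA.
by apply: DiagS => //; exists m; rewrite linearZ /= mub scaler0.
Qed.

(** The domain of the graph is a subalgebra, so [L] only has to contain the eigenvalues met in the
    generators. *)
Lemma diag_rel_total_of_generators n (x : 'I_n -> B) :
  (forall b, exists p : mpoly.mpoly n K, b = mpoly.mmap (in_alg B) x p) ->
  (forall i, exists c, diag_rel chi (x i) c) ->
  forall b, exists c, diag_rel chi b c.
Proof.
move=> gen totx b; have [p ->] := gen b; rewrite /mpoly.mmap.
pose dom u := exists c, diag_rel chi u c.
have domM u v : dom u -> dom v -> dom (u * v).
  by move=> [c uc] [d vd]; exists (c * d); apply: diag_relM.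
have dom_scalar k : dom k%:A by exists k%:A; apply: diag_rel_scalar.
have dom1 : dom 1 by rewrite -(scale1r 1); apply: dom_scalar.
have domX u k : dom u -> dom (u ^+ k).
  by move=> domu; elim: k => // k IHk; rewrite exprS; apply: domM.
apply: (big_ind dom) => [|u v [c uc] [d vd]|m _].
- by exists 0; apply: Diag0.
- by exists (c + d); apply: diag_relD.
apply: (domM); first exact: dom_scalar.
by rewrite /mpoly.mmap1; apply: (big_ind dom) => // i _; apply: domX.
Qed.

(** The domain depends on [L] alone, so totality for a character gives totality for its inverse. *)
Lemma diag_rel_change ch ch' x y :
  diag_rel ch x y -> exists z, diag_rel ch' x z.
Proof.
elim=> [|mu b u v Lmu mub _ [z uz]]; first by exists 0; apply: Diag0.
by exists (ch' mu *: b + z); apply: DiagS.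
Qed.

End Diagonal.

Lemma isotropy_of_character (L : K -> Prop) (chi : K -> K) :
  partial_character L chi -> (forall b, exists c, diag_rel L chi b c) ->
  exists phi : {lrmorphism B -> B},
    isotropy D phi /\ forall b, diag_rel L chi b (phi b).
Proof.
move=> charL tot; have [[L0 chi0] chiD chi_neq0] := charL.
(* The graph of the inverse character is the converse graph, which yields surjectivity and
   injectivity. *)
pose chi' x := (chi x)^-1.
have charL' : partial_character L chi'.
  split; first by rewrite /chi' chi0 invr1.
    by move=> x y Lx Ly; have [Lxy e] := chiD x y Lx Ly; rewrite /chi' e invfM.
  by move=> x Lx; rewrite invr_eq0 chi_neq0.
have inv1 b c : diag_rel L chi b c -> diag_rel L chi' c b.
  by apply: diag_rel_inv => mu Lmu; rewrite mulVf ?chi_neq0.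
have tot' : forall b, exists c, diag_rel L chi' b c.
  by move=> b; have [c /diag_rel_change] := tot b; apply.
have inv2 b c : diag_rel L chi' b c -> diag_rel L chi c b.
  by apply: diag_rel_inv => mu Lmu; rewrite mulfV ?chi_neq0.
apply: isotropy_of_relation => //.
- by move=> c; have [b /inv2 cb] := tot' c; exists b.
- by move=> b c c'; apply: diag_rel_functional.
- by move=> b b' c /inv1 cb /inv1; apply: diag_rel_functional.
- by have := diag_rel_scalar charL 1; rewrite scale1r.
- by move=> b c b' c'; apply: diag_relD.
- by move=> b c b' c'; apply: diag_relM.
- move=> k b c bc; rewrite -(mulr_algl k b) -(mulr_algl k c); apply: diag_relM => //.
  exact: diag_rel_scalar.
by move=> b c; apply: diag_rel_derivation.
Qed.

Lemma isotropy_nontrivial_of_eigenvalue (charK0 : [pchar K] =i pred0) a b :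
  affine B ->
  (forall v, exists2 s : seq (K * B), (forall t, t \in s -> gen_eigen D t.1 t.2)
     & v = \sum_(t <- s) t.2) ->
  a != 0 -> b != 0 -> gen_eigen D a b ->
  exists phi : {lrmorphism B -> B}, isotropy D phi /\ ~ (forall b, phi b = b).
Proof.
move=> [n [x gen]] dec a_neq0 b_neq0 ab.
have [s sP] := functional_choice
  (fun i (s : seq (K * B)) => (forall t, t \in s -> gen_eigen D t.1 t.2) /\
     x i = \sum_(t <- s) t.2)
  (fun i => let: ex_intro2 s sE def_x := dec (x i) in ex_intro _ s (conj sE def_x)).
pose eigenvalues := flatten [seq map fst (s i) | i : 'I_n].
have [L [chi [charL La chia sL]]] := exists_partial_character charK0 eigenvalues a_neq0.
have [|phi [isophi phiP]] := isotropy_of_character charL.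
  apply: (diag_rel_total_of_generators charL gen) => i; have [siE ->] := sP i.
  have siL t : t \in s i -> L t.1.
    move=> ti; apply: sL; apply/flattenP; exists (map fst (s i)).
      by apply/imageP; exists i.
    exact: map_f.
  elim: (s i) siE siL => [|t r IHr] rE rL.
    by exists 0; rewrite big_nil; apply: Diag0.
  have [u ru|u ru|c rc] := IHr.
  - by apply: rE; rewrite inE ru orbT.
  - by apply: rL; rewrite inE ru orbT.
  exists (chi t.1 *: t.2 + c); rewrite big_cons.
  by apply: DiagS => //; [apply: rL | apply: rE]; apply: mem_head.
(* On [b] the map is multiplication by [chi a], which differs from 1. *)
exists phi; split=> // phi_id; have /eqP := phi_id b.
rewrite (diag_rel_functional (phiP b) (diag_rel_eigen chi La ab)).
rewrite -[X in _ == X]scale1r -subr_eq0 -scalerBl scaler_eq0 subr_eq0.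
by rewrite (negPf chia) (negPf b_neq0).
Qed.

End DerivationAutomorphisms.

(** * The exponential of a locally nilpotent derivation *)

Section Exponential.

Variables (K : fieldType) (charK0 : [pchar K] =i pred0) (B : comAlgType K).
Variables (D : {linear B -> B}) (derD : derivation D).

Lemma map_derivationM (p q : {poly B}) :
  map_poly D (p * q) = p * map_poly D q + q * map_poly D p.
Proof.
apply/polyP=> n; rewrite (mulrC q) coefD !coef_map /= !coefM linear_sum -big_split.
by apply: eq_bigr => i _; rewrite /= !coef_map derD [X in _ + X]mulrC.
Qed.

Lemma horner_map_derivation (p : {poly B}) k :
  (map_poly D p).[k%:A] = D p.[k%:A].
Proof.
rewrite (horner_coef_wide _ (size_poly _ _)) horner_coef linear_sum.
apply: eq_bigr => i _; rewrite coef_map /= exprZn expr1n.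
by rewrite !mulr_algr linearZ.
Qed.

(** D kills the coefficients of X + k, so coefficientwise D commutes with this substitution. *)
Lemma map_derivation_shift (p : {poly B}) k :
  map_poly D (p \Po ('X + k%:A%:P)) = map_poly D p \Po ('X + k%:A%:P).
Proof.
have DX : map_poly D ('X + k%:A%:P) = 0.
  apply/polyP=> i; rewrite coef_map coefD coefX coefC coef0 /=.
  case: i => [|[|i]] /=; rewrite ?add0r ?addr0 ?linear0 ?derivation_scalar //.
  exact: derivation_one.
elim/poly_ind: p => [|p c IHp]; first by rewrite comp_poly0 !raddf0.
have mapX : map_poly D 'X = 0.
  apply/polyP=> i; rewrite coef_map coefX coef0 /=.
  by case: (_ == _); rewrite ?linear0 ?derivation_one.
rewrite comp_polyD comp_polyC comp_polyM comp_polyX !raddfD /=.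
rewrite !map_derivationM IHp DX mapX !mulr0 !add0r comp_polyM comp_polyX.
by congr (_ + _); rewrite ?map_polyC ?comp_polyC // mulrC.
Qed.

(* [exp_rel t b c] says that c = exp(t D) b: p is the solution of p' = D p with
   p(0) = b, and c = p(t). *)
Definition exp_rel (t : K) (b c : B) : Prop :=
  exists p : {poly B}, [/\ p^`() = map_poly D p, p`_0 = b & p.[t%:A] = c].

(** On coefficients the equation reads (i + 1) p_(i+1) = D p_i, and characteristic zero lets it be
    solved for p_(i+1). *)
Lemma exp_rel_functional t b c c' : exp_rel t b c -> exp_rel t b c' -> c = c'.
Proof.
move=> [p [dp p0 <-]] [q [dq q0 <-]]; congr (_.[_]); apply/polyP.
elim=> [|i IHi]; first by rewrite p0 q0.
have: p`_i.+1 *+ i.+1 = q`_i.+1 *+ i.+1.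
  by rewrite -!coef_deriv dp dq !coef_map IHi.
rewrite -!scaler_nat => /(congr1 ( *:%R (i.+1%:R^-1 : K))).
by rewrite !scalerA mulVf ?natr_eq0_char0 // !scale1r.
Qed.

Lemma exp_rel_const t a : D a = 0 -> exp_rel t a a.
Proof.
move=> Da0; exists a%:P; rewrite derivC coefC hornerC map_polyC /= Da0.
by split.
Qed.

Lemma exp_relD t b c b' c' :
  exp_rel t b c -> exp_rel t b' c' -> exp_rel t (b + b') (c + c').
Proof.
move=> [p [dp p0 <-]] [q [dq q0 <-]]; exists (p + q).
by rewrite derivD raddfD dp dq coefD p0 q0 hornerD.
Qed.

(** Both d/dX and coefficientwise D are derivations of B[X], so products of solutions are
    solutions. *)
Lemma exp_relM t b c b' c' :
  exp_rel t b c -> exp_rel t b' c' -> exp_rel t (b * b') (c * c').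
Proof.
move=> [p [dp p0 <-]] [q [dq q0 <-]]; exists (p * q).
rewrite derivM map_derivationM dp dq coef0M p0 q0 hornerM.
by split=> //; ring.
Qed.

Lemma exp_rel_derivation t b c : exp_rel t b c -> exp_rel t (D b) (D c).
Proof.
move=> [p [dp p0 <-]]; exists (map_poly D p); split.
- apply/polyP=> i.
  by rewrite coef_deriv coef_map -raddfMn -coef_deriv dp !coef_map.
- by rewrite coef_map p0.
exact: horner_map_derivation.
Qed.

(** The translate p(X + t) solves the same equation, starts at c and takes the value b at -t. *)
Lemma exp_rel_sym t b c : exp_rel t b c -> exp_rel (- t) c b.
Proof.
move=> [p [dp p0 <-]]; exists (p \Po ('X + t%:A%:P)); split.
- rewrite deriv_comp derivD derivX derivC addr0 mulr1 dp.
  by rewrite map_derivation_shift.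
- by rewrite -horner_coef0 horner_comp !hornerE.
by rewrite horner_comp !hornerE -scalerDl addNr scale0r horner_coef0.
Qed.

Lemma iter_eq0 m n (b : B) : iter m D b = 0 -> (m <= n)%N -> iter n D b = 0.
Proof.
move=> b0 /subnK <-; rewrite iterD b0; elim: (n - m)%N => // k IHk /=.
by rewrite IHk linear0.
Qed.

(** The Taylor coefficients D^i b / i! solve the recursion; truncation at m is exact because D^m b =
    0. *)
Lemma exp_rel_nilpotent t m b : iter m D b = 0 ->
  exp_rel t b (\sum_(i < m) (t ^+ i / i`!%:R) *: iter i D b).
Proof.
move=> b0; pose E i := (i`!%:R^-1 : K) *: iter i D b.
exists (\poly_(i < m) E i); split.
- apply/polyP=> i; rewrite coef_deriv coef_map !coef_poly /= /E.
  case: (ltngtP i.+1 m) => [_|_|def_m].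
  + rewrite linearZ /= -scaler_nat scalerA; congr (_ *: _).
    by rewrite factS natrM invfM mulrA mulfV ?natr_eq0_char0 // mul1r.
  + by rewrite mul0rn linear0.
  by rewrite mul0rn linearZ /= -iterS def_m b0 scaler0.
- rewrite coef_poly /E; case: ltnP => [_|]; first by rewrite fact0 invr1 scale1r.
  by rewrite leqn0 => /eqP m0; rewrite m0 in b0.
rewrite horner_poly; apply: eq_bigr => i _.
by rewrite exprZn expr1n mulr_algr scalerA.
Qed.

Lemma isotropy_nontrivial_of_nilpotent :
  (forall b, exists m, iter m D b = 0) -> ~ (forall b, D b = 0) ->
  exists phi : {lrmorphism B -> B}, isotropy D phi /\ ~ (forall b, phi b = b).
Proof.
move=> nilD D_neq0.
have tot t b : exists c, exp_rel t b c.
  by have [m /(exp_rel_nilpotent t)] := nilD b; eexists; eassumption.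
have [|||||||||phi [isophi phiP]] := @isotropy_of_relation K B D (exp_rel 1).
- exact: tot.
(* A preimage of c is exp(- D) c. *)
- move=> c; have [b /exp_rel_sym] := tot (- 1) c.
  by rewrite opprK; exists b.
- by move=> b c c'; apply: exp_rel_functional.
- move=> b b' c /exp_rel_sym cb /exp_rel_sym; exact: exp_rel_functional cb.
- by apply: exp_rel_const; apply: derivation_one.
- by move=> b c b' c'; apply: exp_relD.
- by move=> b c b' c'; apply: exp_relM.
- move=> k b c bc; rewrite -(mulr_algl k b) -(mulr_algl k c); apply: exp_relM => //.
  by apply: exp_rel_const; apply: derivation_scalar.
- by move=> b c; apply: exp_rel_derivation.
exists phi; split=> // phi_id; apply: D_neq0 => b; apply/eqP/negPn/negP => Db.
have [m0 /eqP b0] := nilD b.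
have [[|[|m]] /eqP mb min_m] := ex_minnP (ex_intro (fun m => iter m D b == 0) _ b0).
- by rewrite [b]mb linear0 eqxx in Db.
- by rewrite [D b]mb eqxx in Db.
(* The minimal exponent is [m.+2], so D v is nonzero while D^2 v = 0, and exp(D) v = v + D v. *)
pose v := iter m D b.
have DDv : iter 2 D v = 0 by rewrite -iterD.
have /eqP := phi_id v.
rewrite (exp_rel_functional (phiP v) (exp_rel_nilpotent 1 DDv)).
rewrite big_ord_recl big_ord1 /= !expr1n !invr1 mulr1 !scale1r.
rewrite -subr_eq0 addrAC subrr add0r => Dv; have := min_m m.+1 Dv.
by rewrite ltnn.
Qed.

End Exponential.

(** * The dichotomy between a nonzero eigenvalue and local nilpotency *)

Theorem proposition3p1 (K : closedFieldType) (charK0 : [pchar K] =i pred0)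
    (B : comAlgType K) (affB : affine B)
    (D : {linear B -> B}) (derD : derivation D) (lfD : locally_finite D)
    (D_neq0 : ~ (forall b : B, D b = 0)) :
  exists phi : {lrmorphism B -> B},
    isotropy D phi /\ ~ (forall b : B, phi b = b).
Proof.
have dec v := gen_eigen_decomposition v lfD.
have [[a [b [a_neq0 b_neq0 ab]]]|no_eigen] :=
    classic (exists a b, [/\ a != 0, b != 0 & gen_eigen D a b]).
  exact (isotropy_nontrivial_of_eigenvalue derD charK0 affB dec a_neq0 b_neq0 ab).
apply: isotropy_nontrivial_of_nilpotent => // v.
(* Components for nonzero eigenvalues vanish, and those for 0 are killed by a power of D. *)
have [s sE ->] := dec v; elim: s sE => [|[a b] s IHs] sE.
  by exists 0%N; rewrite big_nil.
have [|m mP] := IHs; first by move=> t ts; apply: sE; rewrite inE ts orbT.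
have [n nP] : exists n, iter n D b = 0.
  have /= ab := sE _ (mem_head _ _).
  have [a0|a_neq0] := eqVneq a 0.
    have [n] := ab; rewrite a0 subr0 => nb; exists n; rewrite -nb {ab sE nb}.
    elim: n b => [|n IHn] b; first by rewrite expr0 (pactC D 1) scale1r.
    by rewrite exprSr pactM pactX -IHn -iterSr.
  exists 0%N; apply/eqP/negPn/negP => b_neq0; apply: no_eigen.
  by exists a, b.
(* The sum bounds both exponents, so this iterate kills the new component and the rest. *)
exists (m + n)%N; rewrite big_cons -[iter _ _ _]scale1r.
have := iter_linear D (m + n) 1 b (\sum_(t <- s) t.2); rewrite !scale1r => ->.
by rewrite (iter_eq0 nP) ?leq_addl // (iter_eq0 mP) ?leq_addr // addr0.
Qed.
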